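(* Let $(\mathcal{A},[\cdot,\cdot],\mu,\alpha)$ be a Hom-Poisson superalgebra over $\mathbb{K}$, let $\lambda\in\mathbb{K}$, and let $\mathcal{R}:\mathcal{A}\to\mathcal{A}$ be an even linear map such that $(\mathcal{R},\mathcal{R})$ is a Rota-Baxter operator of weight $(\lambda,\lambda)$ on $(\mathcal{A},[\cdot,\cdot],\mu,\alpha)$. Define, for all homogeneous $x,y\in\mathcal{A}$, $$\mu_{\mathcal{R}}(x,y)=\mu(\mathcal{R}(x),y)+\mu(x,\mathcal{R}(y))+\lambda\mu(x,y),\qquad [x,y]_{\mathcal{R}}=[\mathcal{R}(x),y]+[x,\mathcal{R}(y)]+\lambda[x,y].$$ Then $(\mathcal{A},[\cdot,\cdot]_{\mathcal{R}},\mu_{\mathcal{R}},\alpha)$ is a Hom-Poisson superalgebra.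
   Context: $\mathbb{K}$ is a field of characteristic zero; all vector spaces are $\mathbb{Z}_2$-graded over $\mathbb{K}$; $|x|$ denotes the parity of a homogeneous element $x$; $\mathcal{H}(\mathcal{A})$ is the set of homogeneous elements of $\mathcal{A}$. Even (multi)linear maps preserve the grading. Identities are required for all homogeneous elements. A Hom-associative superalgebra $(\mathcal{A},\mu,\alpha)$: $\alpha:\mathcal{A}\to\mathcal{A}$ even linear, $\mu:\mathcal{A}\times\mathcal{A}\to\mathcal{A}$ even bilinear, with $\mu(\mu(x,y),\alpha(z))=\mu(\alpha(x),\mu(y,z))$. It is commutative if $\mu(x,y)=(-1)^{|x||y|}\mu(y,x)$. A Hom-Lie superalgebra $(\mathcal{A},[\cdot,\cdot],\alpha)$: $\alpha$ even linear, $[\cdot,\cdot]$ even bilinear, with $[x,y]=-(-1)^{|x||y|}[y,x]$ and $[\alpha(x),[y,z]]=[[x,y],\alpha(z)]+(-1)^{|x||y|}[\alpha(y),[x,z]]$. A Hom-Poisson superalgebra $(\mathcal{A},[\cdot,\cdot],\mu,\alpha)$: $(\mathcal{A},[\cdot,\cdot],\alpha)$ is a Hom-Lie superalgebra, $(\mathcal{A},\mu,\alpha)$ is a commutative Hom-associative superalgebra, and $[\alpha(x),\mu(y,z)]=\mu([x,y],\alpha(z))+(-1)^{|x||y|}\mu(\alpha(y),[x,z])$. A Rota-Baxter operator of weight $\lambda$ on a Hom-associative superalgebra $(\mathcal{A},\mu,\alpha)$ is an even linear map $\mathcal{R}$ commuting with $\alpha$ and satisfying $\mu(\mathcal{R}(x),\mathcal{R}(y))=\mathcal{R}\big(\mu(\mathcal{R}(x),y)+\mu(x,\mathcal{R}(y))+\lambda\mu(x,y)\big)$.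 A Rota-Baxter operator of weight $\lambda$ on a Hom-Lie superalgebra $(\mathcal{A},[\cdot,\cdot],\alpha)$ is an even linear map $\mathcal{R}$ commuting with $\alpha$ and satisfying $[\mathcal{R}(x),\mathcal{R}(y)]=\mathcal{R}\big([\mathcal{R}(x),y]+[x,\mathcal{R}(y)]+\lambda[x,y]\big)$. A Rota-Baxter operator of weight $(\lambda,\lambda')$ on a Hom-Poisson superalgebra $(\mathcal{A},[\cdot,\cdot],\mu,\alpha)$ is a pair $(\mathcal{R},\mathcal{R}')$ of commuting even linear maps on $\mathcal{A}$ such that $\mathcal{R}$ is a Rota-Baxter operator of weight $\lambda$ on $(\mathcal{A},\mu,\alpha)$ and $\mathcal{R}'$ is a Rota-Baxter operator of weight $\lambda'$ on $(\mathcal{A},[\cdot,\cdot],\alpha)$. *)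

(* Defs.v *)
From HB Require Import structures.
From mathcomp Require Import all_boot all_order all_algebra.

Set Implicit Arguments.
Unset Strict Implicit.
Unset Printing Implicit Defensive.

Import GRing.Theory.
Local Open Scope ring_scope.

(* Z_2 is encoded by bool with addition (+): false is the even parity, true
   the odd one.  The component of parity i is the Prop-valued predicate
   [homog i], so that subspaces need not be decidable and A may be
   infinite-dimensional.  The vector 0 is homogeneous of both parities. *)
Record superspace (K : fieldType) (A : lmodType K) := Superspace {
  homog : bool -> A -> Prop;
  homog0 : forall i, homog i 0;
  homogP : forall i (a : K) x y,
    homog i x -> homog i y -> homog i (a *: x + y);
  homog_sum : forall x, exists x0 x1,
    [/\ homog false x0, homog true x1 & x = x0 + x1];
  homog_direct : forall x, homog false x -> homog true x -> x = 0
}.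

Section HomPoisson.

Variables (K : fieldType) (A : lmodType K) (S : superspace A).
Implicit Types (br mu op : A -> A -> A) (alpha R : A -> A) (lambda : K).

(* (-1)^{|x||y|} for parities i = |x| and j = |y| *)
Definition koszul (i j : bool) : K := (-1) ^+ (i * j)%N.

Definition even_linear (f : A -> A) : Prop :=
  linear f /\ (forall i x, homog S i x -> homog S i (f x)).

Definition even_bilinear op : Prop :=
  [/\ forall y, linear (op ^~ y),
      forall x, linear (op x)
    & forall i j x y,
        homog S i x -> homog S j y -> homog S (i (+) j) (op x y)].

Record hom_assoc_superalgebra mu alpha : Prop := {
  hom_assoc_alpha : even_linear alpha;
  hom_assoc_mu : even_bilinear mu;
  hom_associativity : forall i j k x y z,
    homog S i x -> homog S j y -> homog S k z ->
    mu (mu x y) (alpha z) = mu (alpha x) (mu y z)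
}.

Definition supercommutative mu : Prop :=
  forall i j x y, homog S i x -> homog S j y ->
    mu x y = koszul i j *: mu y x.

Record hom_Lie_superalgebra br alpha : Prop := {
  hom_Lie_alpha : even_linear alpha;
  hom_Lie_br : even_bilinear br;
  hom_Lie_skew : forall i j x y, homog S i x -> homog S j y ->
    br x y = - (koszul i j *: br y x);
  hom_Lie_Jacobi : forall i j k x y z,
    homog S i x -> homog S j y -> homog S k z ->
    br (alpha x) (br y z) =
      br (br x y) (alpha z) + koszul i j *: br (alpha y) (br x z)
}.

Record hom_Poisson_superalgebra br mu alpha : Prop := {
  hom_Poisson_Lie : hom_Lie_superalgebra br alpha;
  hom_Poisson_assoc : hom_assoc_superalgebra mu alpha;
  hom_Poisson_comm : supercommutative mu;
  hom_Poisson_Leibniz : forall i j k x y z,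
    homog S i x -> homog S j y -> homog S k z ->
    br (alpha x) (mu y z) =
      mu (br x y) (alpha z) + koszul i j *: mu (alpha y) (br x z)
}.

Definition RB_deform R lambda op : A -> A -> A :=
  fun x y => op (R x) y + op x (R y) + lambda *: op x y.

(* The same axioms serve for a Hom-associative product (op = mu) and for a
   Hom-Lie bracket (op = [.,.]). *)
Record Rota_Baxter lambda op alpha R : Prop := {
  RB_even : even_linear R;
  RB_alpha : forall x, R (alpha x) = alpha (R x);
  RB_eq : forall i j x y, homog S i x -> homog S j y ->
    op (R x) (R y) = R (op (R x) y + op x (R y) + lambda *: op x y)
}.

Record Rota_Baxter_Poisson lambda lambda' br mu alpha R R' : Prop := {
  RBP_commute : forall x, R (R' x) = R' (R x);
  RBP_mu : Rota_Baxter lambda mu alpha R;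
  RBP_br : Rota_Baxter lambda' br alpha R'
}.

End HomPoisson.

(* Main.v *)
Require Import Defs.
From mathcomp Require Import all_boot all_order all_algebra.

(** Every axiom of a Hom-Poisson superalgebra on three arguments is a linear
    relation between nested products such as [p (alpha x) (q y z)] or
    [q (p x y) (alpha z)].  The Rota-Baxter identity says that [R] is a morphism
    from the deformed product to the original one, so the factor [R (q_R y z)]
    met when a nested product is deformed equals [q (R y) (R z)].  After this
    substitution the deformation of a nested trilinear map [t] becomes

      t(Rx,Ry,z) + t(Rx,y,Rz) + t(x,Ry,Rz)
        + lambda (t(Rx,y,z) + t(x,Ry,z) + t(x,y,Rz)) + lambda^2 t(x,y,z),

    the sum of [t] over the nonempty sets of arguments left free of [R], with
    weight a power of [lambda].  This expression ([tri_deform]) does not depend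
    on the shape of the nesting ([RB_deform_nested_right],
    [RB_deform_nested_left]), is linear in [t], and is compatible with
    permutations of the arguments.  A linear relation between nested products
    that holds on homogeneous elements, with coefficients depending on parities
    only, is therefore inherited by the deformed products, because [R] is even.
    Hom-associativity is one instance, and the Hom-Jacobi and Hom-Leibniz
    identities are both instances of [RB_deform_Leibniz]. *)

Set Implicit Arguments.
Unset Strict Implicit.
Unset Printing Implicit Defensive.

Import GRing.Theory.
Local Open Scope ring_scope.

Section Superspace.

Variables (K : fieldType) (A : lmodType K) (S : superspace A).
Implicit Types (p q op : A -> A -> A) (t : A -> A -> A -> A).

Lemma homogZ i (a : K) x : homog S i x -> homog S i (a *: x).
Proof. by move=> Hx; rewrite -[a *: x]addr0; apply: homogP (homog0 S i). Qed.

Lemma homogD i x y : homog S i x -> homog S i y -> homog S i (x + y).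
Proof. by move=> Hx; rewrite -[x]scale1r; apply: homogP. Qed.

Lemma linearD_of (f : A -> A) : linear f -> {morph f : x y / x + y}.
Proof. by move=> lin_f x y; rewrite -[x]scale1r lin_f !scale1r. Qed.

Lemma linearZ_of (f : A -> A) : linear f -> forall a, {morph f : x / a *: x}.
Proof. by move=> lin_f; apply: GRing.scalable_linear. Qed.

Variables (lambda : K) (alpha R : A -> A).
Hypothesis R_even : even_linear S R.

Lemma RB_deform_even_bilinear op :
  even_bilinear S op -> even_bilinear S (RB_deform R lambda op).
Proof.
case: R_even => R_lin R_homog [op_linl op_linr op_homog]; split.
- move=> y a u v; rewrite /RB_deform R_lin !(op_linl _ a).
  rewrite !scalerDr !scalerA (mulrC lambda) -!scalerA.
  by rewrite !addrA [LHS](ACl (1*3*5*2*4*6)).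
- move=> x a u v; rewrite /RB_deform R_lin !(op_linr _ a).
  rewrite !scalerDr !scalerA (mulrC lambda) -!scalerA.
  by rewrite !addrA [LHS](ACl (1*3*5*2*4*6)).
- move=> i j x y Hx Hy; rewrite /RB_deform.
  by apply: homogD; [apply: homogD|apply: homogZ]; apply: op_homog; auto.
Qed.

(** Both supercommutativity and super skew-symmetry have this form, with
    [c] the sign of the parities or its opposite. *)
Lemma RB_deform_symmetry op i j (c : K) :
    (forall x y, homog S i x -> homog S j y -> op x y = c *: op y x) ->
  forall x y, homog S i x -> homog S j y ->
    RB_deform R lambda op x y = c *: RB_deform R lambda op y x.
Proof.
case: R_even => _ R_homog op_sym x y Hx Hy; rewrite /RB_deform.
rewrite (op_sym (R x) y) ?(op_sym x (R y)) ?(op_sym x y); auto.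
rewrite !scalerDr !scalerA (mulrC c lambda).
by congr (_ + _); rewrite addrC.
Qed.

(** The ternary analogue of [RB_deform]: the subset expansion of [t] over the
    arguments that [R] is not applied to. *)
Definition tri_deform t x y z : A :=
  t (R x) (R y) z + t (R x) y (R z) + t x (R y) (R z)
  + lambda *: (t (R x) y z + t x (R y) z + t x y (R z) + lambda *: t x y z).

Lemma eq_tri_deform i j k t t' :
    (forall x y z, homog S i x -> homog S j y -> homog S k z ->
       t x y z = t' x y z) ->
  forall x y z, homog S i x -> homog S j y -> homog S k z ->
    tri_deform t x y z = tri_deform t' x y z.
Proof.
case: R_even => _ R_homog eq_t x y z Hx Hy Hz; rewrite /tri_deform.
by rewrite !eq_t; auto.
Qed.

Lemma tri_deformD t t' x y z :
  tri_deform (fun x y z => t x y z + t' x y z) x y z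
  = tri_deform t x y z + tri_deform t' x y z.
Proof.
rewrite /tri_deform !scalerDr !addrA.
by rewrite [LHS](ACl (1*3*5*7*9*11*13*2*4*6*8*10*12*14)).
Qed.

Lemma tri_deformZ c t x y z :
  tri_deform (fun x y z => c *: t x y z) x y z = c *: tri_deform t x y z.
Proof.
have ZC v : c *: (lambda *: v) = lambda *: (c *: v) by rewrite !scalerA mulrC.
by rewrite /tri_deform !scalerDr !ZC.
Qed.

Lemma tri_deform_swap t x y z :
  tri_deform (fun x y z => t y x z) x y z = tri_deform t y x z.
Proof.
rewrite /tri_deform (addrAC (t (R y) (R x) z)).
by rewrite (addrC (t y (R x) z)).
Qed.

Hypothesis R_alpha : forall x, R (alpha x) = alpha (R x).

(** The Rota-Baxter identity of the inner product [q] replaces [R (q_R y z)] by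
    [q (R y) (R z)], and the rest is bilinearity of the outer product [p].  Two
    different products can thus be nested, as in the Leibniz identity. *)
Lemma RB_deform_nested_right p q i j x y z :
    even_bilinear S p -> Rota_Baxter S lambda q alpha R ->
    homog S i y -> homog S j z ->
  RB_deform R lambda p (alpha x) (RB_deform R lambda q y z)
  = tri_deform (fun x y z => p (alpha x) (q y z)) x y z.
Proof.
move=> [_ p_linr _] RBq Hy Hz.
rewrite {1}/RB_deform {2}/RB_deform -(RB_eq RBq Hy Hz) R_alpha /RB_deform.
rewrite !(linearD_of (p_linr _)) !(linearZ_of (p_linr _)) /tri_deform.
rewrite !scalerDr !addrA.
by rewrite [LHS](ACl (1*2*4*3*5*6*7)).
Qed.

Lemma RB_deform_nested_left p q i j x y z :
    even_bilinear S p -> Rota_Baxter S lambda q alpha R ->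
    homog S i x -> homog S j y ->
  RB_deform R lambda p (RB_deform R lambda q x y) (alpha z)
  = tri_deform (fun x y z => p (q x y) (alpha z)) x y z.
Proof.
move=> [p_linl _ _] RBq Hx Hy.
rewrite {1}/RB_deform {1}/RB_deform -(RB_eq RBq Hx Hy) R_alpha /RB_deform.
have pD u v w : p (u + v) w = p u w + p v w by apply: linearD_of (p_linl w) _ _.
have pZ a u w : p (a *: u) w = a *: p u w by apply: linearZ_of (p_linl w) _ _.
rewrite !pD !pZ /tri_deform !scalerDr !addrA.
by rewrite [LHS](ACl (1*2*3*5*6*4*7)).
Qed.

Lemma RB_deform_assoc op :
    even_bilinear S op -> Rota_Baxter S lambda op alpha R ->
    (forall i j k x y z, homog S i x -> homog S j y -> homog S k z ->
       op (op x y) (alpha z) = op (alpha x) (op y z)) ->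
  let op_R := RB_deform R lambda op in
  forall i j k x y z, homog S i x -> homog S j y -> homog S k z ->
    op_R (op_R x y) (alpha z) = op_R (alpha x) (op_R y z).
Proof.
move=> op_bil RBop opA op_R i j k x y z Hx Hy Hz.
rewrite /op_R.
rewrite (RB_deform_nested_left _ op_bil RBop Hx Hy).
rewrite (RB_deform_nested_right _ op_bil RBop Hy Hz).
exact: eq_tri_deform (opA i j k) _ _ _ Hx Hy Hz.
Qed.

(** The twisted left multiplications of [p] act as superderivations of [q]:
    this is the Hom-Jacobi identity for [p = q = br], and the Hom-Leibniz
    identity for [p = br] and [q = mu]. *)
Lemma RB_deform_Leibniz p q :
    even_bilinear S p -> even_bilinear S q ->
    Rota_Baxter S lambda p alpha R -> Rota_Baxter S lambda q alpha R ->
    (forall i j k x y z, homog S i x -> homog S j y -> homog S k z ->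
       p (alpha x) (q y z)
       = q (p x y) (alpha z) + koszul K i j *: q (alpha y) (p x z)) ->
  let p_R := RB_deform R lambda p in let q_R := RB_deform R lambda q in
  forall i j k x y z, homog S i x -> homog S j y -> homog S k z ->
    p_R (alpha x) (q_R y z)
    = q_R (p_R x y) (alpha z) + koszul K i j *: q_R (alpha y) (p_R x z).
Proof.
move=> p_bil q_bil RBp RBq pq p_R q_R i j k x y z Hx Hy Hz.
rewrite /p_R /q_R.
rewrite (RB_deform_nested_right _ p_bil RBq Hy Hz).
rewrite (RB_deform_nested_left _ q_bil RBp Hx Hy).
rewrite (RB_deform_nested_right _ q_bil RBp Hx Hz).
rewrite (eq_tri_deform (pq i j k) Hx Hy Hz) tri_deformD tri_deformZ.
(* The last term is the nested product with [x] and [y] exchanged, hence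
   the swap. *)
by congr (_ + _ *: _);
  apply: (tri_deform_swap (fun y x z => q (alpha y) (p x z))).
Qed.

End Superspace.

Theorem theorem1p1 (K : fieldType) (charK0 : [pchar K] =i pred0)
    (A : lmodType K) (S : superspace A)
    (br mu : A -> A -> A) (alpha : A -> A)
    (HA : hom_Poisson_superalgebra S br mu alpha)
    (lambda : K) (R : A -> A) (R_even : even_linear S R)
    (HR : Rota_Baxter_Poisson S lambda lambda br mu alpha R R) :
  hom_Poisson_superalgebra S
    (RB_deform R lambda br) (RB_deform R lambda mu) alpha.
Proof.
case: HA => [[alpha_even br_bil br_skew Jacobi] [_ mu_bil muA] muC Leibniz].
case: HR => _ RBmu RBbr; have R_alpha := RB_alpha RBmu.
split.
- split=> //; first by apply: RB_deform_even_bilinear.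
  + move=> i j x y Hx Hy; rewrite -scaleNr.
    apply: (RB_deform_symmetry _ R_even _ Hx Hy) => u v Hu Hv.
    by rewrite scaleNr; apply: br_skew.
  + by apply: RB_deform_Leibniz.
- split=> //; first by apply: RB_deform_even_bilinear.
  exact: RB_deform_assoc.
- move=> i j x y Hx Hy.
  exact: (RB_deform_symmetry _ R_even (muC i j) Hx Hy).
- exact: RB_deform_Leibniz.
Qed.
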